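(* Let $(X,r)$ be an indecomposable solution of finite multipermutation level. Then $(X,r)$ contains no non-trivial subsolutions, i.e. the only subsolution of $(X,r)$ is $X$ itself.
   Context: A solution is a pair $(X,r)$ with $X$ a nonempty set (possibly infinite) and $r:X^2\to X^2$ a bijection, $r(x,y)=(\sigma_x(y),\tau_y(x))$, satisfying the braid equation $(r\times \mathrm{id})(\mathrm{id}\times r)(r\times \mathrm{id})=(\mathrm{id}\times r)(r\times \mathrm{id})(\mathrm{id}\times r)$ with all maps $\sigma_x,\tau_x:X\to X$ bijective. $(X,r)$ is indecomposable if the subgroup of $\mathrm{Perm}(X)$ generated by all $\sigma_x,\tau_x$ ($x\in X$) acts transitively on $X$. The retraction $\mathrm{Ret}(X,r)$ is the induced solution on $X/{\sim}$, where $x\sim y$ iff $\sigma_x=\sigma_y$ and $\tau_x=\tau_y$; $(X,r)$ has finite multipermutation level if some iterated retraction $\mathrm{Ret}^n(X,r)$ ($n\ge 0$) has size $1$. A subsolution is a nonempty subset $Y\subseteq X$ such that $r$ restricts to $Y\times Y$ and $(Y,r|_{Y\times Y})$ is itself a solution (bijective and non-degenerate). *)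

(* Defs.v *)
From mathcomp Require Import all_boot.
From mathcomp Require Import generic_quotient boolp classical_sets.

Set Implicit Arguments.
Unset Strict Implicit.
Unset Printing Implicit Defensive.

Local Open Scope quotient_scope.
Local Open Scope classical_set_scope.

Section Braiding.
Variables (X : Type) (r : X * X -> X * X).

(* r (x, y) = (sigma x y, tau y x) *)
Definition sigma (x y : X) : X := (r (x, y)).1.
Definition tau (y x : X) : X := (r (x, y)).2.

Definition r_id (p : X * X * X) : X * X * X :=
  let: (x, y, z) := p in (r (x, y), z).
Definition id_r (p : X * X * X) : X * X * X :=
  let: (x, y, z) := p in (x, (r (y, z)).1, (r (y, z)).2).

Definition braid_equation : Prop :=
  r_id \o id_r \o r_id =1 id_r \o r_id \o id_r.

Record is_solution : Prop := IsSolution {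
  solution_inhabited : inhabited X;
  solution_bij : bijective r;
  solution_braid : braid_equation;
  solution_sigma_bij : forall x, bijective (sigma x);
  solution_tau_bij : forall x, bijective (tau x) }.

End Braiding.

Record solution : Type := Solution {
  carrier :> Type;
  smap : carrier * carrier -> carrier * carrier;
  smapP : is_solution smap }.

Lemma inj_surj_bij (A B : Type) (f : A -> B) :
  injective f -> (forall y, exists x, f x = y) -> bijective f.
Proof.
move=> f_inj f_surj; exists (fun y => projT1 (cid (f_surj y))) => [x|y].
  by apply: f_inj; case: (cid _).
by case: (cid _).
Qed.

Lemma bij_surj (A B : Type) (f : A -> B) :
  bijective f -> forall y, exists x, f x = y.
Proof. by case=> g _ gK y; exists (g y). Qed.

(* The congruence properties of the retraction relation. The axioms below are
   invariant under exchanging s and t, so that every lemma also yields its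
   mirror image. *)
Section Congruence.
Variables (X : Type) (s t : X -> X -> X).
Hypothesis B1 : forall x y z, s x (s y z) = s (s x y) (s (t y x) z).
Hypothesis B2 : forall x y z,
  t (s (t y x) z) (s x y) = s (t (s y z) x) (t z y).
Hypothesis B3 : forall x y z, t x (t y z) = t (t x y) (t (s y x) z).
Hypothesis sB : forall x, bijective (s x).
Hypothesis tB : forall x, bijective (t x).

Definition same_action (x y : X) : Prop := s x = s y /\ t x = t y.

Lemma same_action_s x y y' :
  same_action y y' -> same_action (s x y) (s x y').
Proof.
case=> es et; split; apply: funext.
  move=> u; case: (bij_surj (sB (t y x)) u) => z <-.
  by rewrite -B1 es B1 et.
by move=> z; apply: (bij_inj (tB (t y x))); rewrite -B3 et B3.
Qed.

Lemma fix_s a : exists y, s y a = y.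
Proof.
have [c tac] := bij_surj (tB a) a.
exists (s c a); have -> // : s (s c a) = s c.
apply: funext => u; case: (bij_surj (sB a) u) => z <-.
by rewrite -{2}tac -B1.
Qed.

Lemma same_action_t_arg b w w' :
  same_action (s b w) (s b w') -> t w b = t w' b.
Proof.
case=> es et; have [y yb] := fix_s b.
have stw v : s (t b y) v = s b v.
  by apply: (bij_inj (sB y)); rewrite -{1}yb -B1.
apply: (bij_inj (sB (t (s b w) y))).
by rewrite -B2 et -B2 !stw et.
Qed.

Lemma same_action_s_inv b w w' :
  same_action (s b w) (s b w') -> same_action w w'.
Proof.
move=> e; have eb := same_action_t_arg e; case: e => es et.
split; apply: funext => z.
  by apply: (bij_inj (sB b)); rewrite B1 es eb -B1.
case: (bij_surj (tB b) z) => x <-.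
by rewrite B3 eb et -B3.
Qed.

End Congruence.

Section SolutionTheory.
Variable X : solution.
Let s := sigma (@smap X).
Let t := tau (@smap X).

Lemma smapE x y : @smap X (x, y) = (s x y, t y x).
Proof. exact: surjective_pairing. Qed.

Lemma braid1 x y z : s x (s y z) = s (s x y) (s (t y x) z).
Proof.
have := solution_braid (smapP X) (x, y, z).
by rewrite /= /r_id /id_r /= !smapE /= => -[].
Qed.

Lemma braid2 x y z : t (s (t y x) z) (s x y) = s (t (s y z) x) (t z y).
Proof.
have := solution_braid (smapP X) (x, y, z).
by rewrite /= /r_id /id_r /= !smapE /= => -[].
Qed.

Lemma braid3 x y z : t x (t y z) = t (t x y) (t (s y x) z).
Proof.
have := solution_braid (smapP X) (z, y, x).
by rewrite /= /r_id /id_r /= !smapE /= => -[].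
Qed.

End SolutionTheory.

Section Retraction.
Variable X : solution.
Let s := sigma (@smap X).
Let t := tau (@smap X).

Definition ret_rel (x y : {classic X}) : bool :=
  `[< sigma (@smap X) x = sigma (@smap X) y /\
      tau (@smap X) x = tau (@smap X) y >].

Lemma ret_rel_equiv : equiv_class_of ret_rel.
Proof.
split=> [x|x y|y x z]; first exact/asboolP.
  by apply/asboolP/asboolP => -[-> ->].
by move=> /asboolP[e1 e2] /asboolP[e3 e4]; apply/asboolP; rewrite e1 e2 e3 e4.
Qed.

Canonical ret_equiv := EquivRelPack ret_rel_equiv.

Definition ret_type : Type := {eq_quot ret_equiv}.

Definition ret_class (x : X) : ret_type :=
  \pi_{eq_quot ret_equiv} (x : {classic X}).

Definition ret_repr (a : ret_type) : X := repr (a : {eq_quot ret_equiv}).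

Lemma ret_classP x y : ret_class x = ret_class y <-> same_action s t x y.
Proof.
split=> [/eqmodP /asboolP //|e]; by apply/eqmodP/asboolP.
Qed.

Lemma ret_reprK a : ret_class (ret_repr a) = a.
Proof. exact: reprK. Qed.

(* Independent of the representatives by ret_mapE below. *)
Definition ret_map (p : ret_type * ret_type) : ret_type * ret_type :=
  let q := smap (ret_repr p.1, ret_repr p.2) in (ret_class q.1, ret_class q.2).

Let sB x : bijective (s x). Proof. exact: solution_sigma_bij (smapP X) x. Qed.
Let tB x : bijective (t x). Proof. exact: solution_tau_bij (smapP X) x. Qed.
Let B1 := @braid1 X.
Let B2 := @braid2 X.
Let B3 := @braid3 X.

Let swap x y : same_action t s x y <-> same_action s t x y.
Proof. by split=> -[]. Qed.

Let class_s x y y' :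
  ret_class (s x y) = ret_class (s x y') <-> ret_class y = ret_class y'.
Proof.
rewrite !ret_classP; split; first exact: same_action_s_inv.
exact: same_action_s.
Qed.

Let B2' x y z : s (t (s y x) z) (t x y) = t (s (t y z) x) (s z y).
Proof. exact/esym/B2. Qed.

Let class_t x y y' :
  ret_class (t x y) = ret_class (t x y') <-> ret_class y = ret_class y'.
Proof.
rewrite !ret_classP -!swap; split.
  exact: (same_action_s_inv B3 B2' B1 tB sB).
exact: (same_action_s B3 B1 tB sB).
Qed.

Lemma ret_mapE x y :
  ret_map (ret_class x, ret_class y) = (ret_class (s x y), ret_class (t y x)).
Proof.
rewrite /ret_map smapE /=.
have /ret_classP[ex _] := ret_reprK (ret_class x).
have /ret_classP[_ ey] := ret_reprK (ret_class y).
congr pair; rewrite -/s -/t.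
  by rewrite ex; apply/class_s; rewrite ret_reprK.
by rewrite ey; apply/class_t; rewrite ret_reprK.
Qed.

Let ret_ind (P : ret_type -> Prop) : (forall x, P (ret_class x)) -> forall a, P a.
Proof. by move=> h a; rewrite -(ret_reprK a). Qed.

Lemma ret_map_inj : injective ret_map.
Proof.
case=> [a b] [a' b']; elim/ret_ind: a => x; elim/ret_ind: b => y.
elim/ret_ind: a' => x'; elim/ret_ind: b' => y'; rewrite !ret_mapE => -[eu ev].
have [w xw] := bij_surj (sB x) (s x' y').
have [c yc] := bij_surj (tB y') (t y x).
have eyw : ret_class y = ret_class w by apply/(class_s x); rewrite eu xw.
have ecx : ret_class c = ret_class x' by apply/(class_t y'); rewrite yc ev.
have tw : t w x = t y x.
  apply: (same_action_t_arg B1 B2 sB tB).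
  by apply/ret_classP/class_s.
have sc : s c y' = s x' y'.
  apply: (same_action_t_arg B3 B2' tB sB).
  by apply/swap/ret_classP/class_t.
have : smap (x, w) = smap (c, y') by rewrite !smapE -/s -/t xw tw sc yc.
by move/(bij_inj (solution_bij (smapP X))) => [-> ew]; rewrite ecx eyw ew.
Qed.

Lemma ret_solution : is_solution ret_map.
Proof.
split.
- by case: (solution_inhabited (smapP X)) => x; exists; exact: (ret_class x).
- apply: (inj_surj_bij ret_map_inj) => -[a b].
  elim/ret_ind: a => u; elim/ret_ind: b => v.
  have [[x y]] := bij_surj (solution_bij (smapP X)) (u, v).
  rewrite smapE => -[<- <-]; exists (ret_class x, ret_class y).
  exact: ret_mapE.
- have E := ret_mapE; move: ret_map E => R E.
  move=> [[a b] c]; elim/ret_ind: a => x; elim/ret_ind: b => y.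
  elim/ret_ind: c => z.
  rewrite /= /r_id /id_r /=; do !rewrite E /=.
  by rewrite /s /t (B1 x y z) (B2 x y z) (B3 z y x).
- move=> a; elim/ret_ind: a => x.
  have E y : sigma ret_map (ret_class x) (ret_class y) = ret_class (s x y).
    by rewrite /sigma ret_mapE.
  apply: inj_surj_bij => [b b'|b].
    elim/ret_ind: b => y; elim/ret_ind: b' => y'; rewrite !E.
    by move/class_s.
  elim/ret_ind: b => y; have [w <-] := bij_surj (sB x) y.
  by exists (ret_class w).
- move=> a; elim/ret_ind: a => x.
  have E y : tau ret_map (ret_class x) (ret_class y) = ret_class (t x y).
    by rewrite /tau ret_mapE.
  apply: inj_surj_bij => [b b'|b].
    elim/ret_ind: b => y; elim/ret_ind: b' => y'; rewrite !E.
    by move/class_t.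
  elim/ret_ind: b => y; have [w <-] := bij_surj (tB x) y.
  by exists (ret_class w).
Qed.

Definition Ret : solution := Solution ret_solution.

End Retraction.

Definition finite_multipermutation_level (X : solution) : Prop :=
  exists n, exists a : iter n Ret X, forall b : iter n Ret X, b = a.

(* Perm(X) is modelled as the bijective functions X -> X; [smallest] is the
   intersection of all subgroups containing the given set. *)
Definition permutation_subgroup (X : Type) (G : set (X -> X)) : Prop :=
  [/\ forall g, G g -> bijective g,
      G id,
      forall g h, G g -> G h -> G (g \o h) &
      forall g h, G g -> cancel g h -> cancel h g -> G h].

Definition permutation_group (X : solution) : set (X -> X) :=
  smallest (@permutation_subgroup X)
    (range (sigma (@smap X)) `|` range (tau (@smap X))).

Definition indecomposable (X : solution) : Prop :=
  forall x y : X, exists2 g, permutation_group g & g x = y.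

Section Subsolutions.
Variables (X : solution) (Y : set X).

Definition stable : Prop := forall p, (Y `*` Y) p -> (Y `*` Y) (smap p).

(* As a type, Y is the subtype {x : X | x \in Y}. *)
Definition restriction (stY : stable) (p : Y * Y) : Y * Y :=
  let q := smap (val p.1, val p.2) in
  let qY := stY (val p.1, val p.2)
    (conj (set_mem (valP p.1)) (set_mem (valP p.2))) in
  (exist _ q.1 (mem_set qY.1), exist _ q.2 (mem_set qY.2)).

Definition subsolution : Prop :=
  exists stY : stable, is_solution (restriction stY).

End Subsolutions.

(* Main.v *)
(** A subsolution [Y] meets every retraction class: its image in [Ret X] is
again closed under the actions of its elements, so this follows by induction on
the multipermutation level. Hence every [x] acts as some element of [Y] does,
every [sigma x] and [tau x] preserves [Y], and so does the permutation group;
transitivity gives [Y = X]. *)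

Require Import Defs.
From mathcomp Require Import all_boot.
From mathcomp Require Import boolp classical_sets.
Local Open Scope classical_set_scope.

Section PermutationGroup.
Variable X : solution.

(** The induction principle for the generated group: a property that cuts out a subgroup and holds
    for the generators holds for every element. *)
Lemma permutation_group_sub (G : set (X -> X)) :
  permutation_subgroup G ->
  (forall x, G (sigma (@smap X) x)) -> (forall x, G (tau (@smap X) x)) ->
  @permutation_group X `<=` G.
Proof.
move=> G_grp Gs Gt; apply: smallest_sub => // g.
by case=> -[x _ <-]; [exact: Gs | exact: Gt].
Qed.

Lemma permutation_group_sigma x : @permutation_group X (sigma (@smap X) x).
Proof. by move=> G [_]; apply; left; exists x. Qed.

Lemma permutation_group_tau x : @permutation_group X (tau (@smap X) x).
Proof. by move=> G [_]; apply; right; exists x. Qed.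

(** All bijections form a subgroup, which contains the generators by non-degeneracy. *)
Lemma permutation_group_bij g : @permutation_group X g -> bijective g.
Proof.
move=> Gg; apply: (permutation_group_sub (fun g => bijective g)) Gg.
- split=> [//| |g1 h1|g1 h1 _ gK hK]; first by exists id.
    exact: bij_comp.
  by exists g1.
- exact: solution_sigma_bij (smapP X).
- exact: solution_tau_bij (smapP X).
Qed.

Lemma permutation_group_subgroup :
  permutation_subgroup (@permutation_group X).
Proof.
split=> [||g h Gg Gh G|g h Gg gK hK G]; first exact: permutation_group_bij.
- by move=> G [[]].
- by move=> [Ggrp sub]; case: (Ggrp) => _ _ GM _; apply: GM;
    [apply: Gg|apply: Gh].
- by move=> [Ggrp sub]; case: (Ggrp) => _ _ _ GV; apply: (GV g) => //;
    apply: Gg.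
Qed.

End PermutationGroup.

Section RetractionMap.
Variable X : solution.

Lemma sigma_Ret (x y : X) :
  sigma (@smap (Ret X)) (ret_class x) (ret_class y) =
  ret_class (sigma (@smap X) x y).
Proof. by rewrite /sigma [smap _]ret_mapE. Qed.

Lemma tau_Ret (x y : X) :
  tau (@smap (Ret X)) (ret_class x) (ret_class y) =
  ret_class (tau (@smap X) x y).
Proof. by rewrite /tau [smap _]ret_mapE. Qed.

(** Having a counterpart on [Ret X] survives composition and inversion, and the generators have one
    by [sigma_Ret] and [tau_Ret]. This carries transitivity over to the retraction. *)
Lemma permutation_group_Ret (g : X -> X) : @permutation_group X g ->
  exists2 h, @permutation_group (Ret X) h &
    forall x, ret_class (g x) = h (ret_class x).
Proof.
have [_ P1 PM PV] := permutation_group_subgroup (Ret X).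
(* Bijectivity is included because [permutation_subgroup] demands it of every member. *)
pose lifts (g : X -> X) := bijective g /\
  exists2 h, @permutation_group (Ret X) h &
    forall x, ret_class (g x) = h (ret_class x).
suff : @permutation_group X `<=` lifts by move=> sub /sub[].
apply: permutation_group_sub.
- split=> [g' []//| |g1 g2|g1 g2].
  + by split; [exists id|exists id].
  + move=> [b1 [h1 H1 e1]] [b2 [h2 H2 e2]]; split; first exact: bij_comp.
    by exists (h1 \o h2); [exact: PM | move=> x /=; rewrite e1 e2].
  + move=> [b1 [h1 H1 e1]] gK hK; split; first by exists g1.
    (* The inverse of [h1] is the counterpart of [g2], the inverse of [g1]. *)
    have [h2 h1K h2K] := permutation_group_bij _ _ H1.
    exists h2; first exact: (PV h1).
    by move=> x; rewrite -{2}(hK x) e1 h1K.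
- move=> x; split; first exact: (solution_sigma_bij (smapP X)).
  exists (sigma (@smap (Ret X)) (ret_class x)) => [|y].
    exact: permutation_group_sigma.
  by rewrite sigma_Ret.
- move=> x; split; first exact: (solution_tau_bij (smapP X)).
  exists (tau (@smap (Ret X)) (ret_class x)) => [|y].
    exact: permutation_group_tau.
  by rewrite tau_Ret.
Qed.

Lemma indecomposable_Ret : indecomposable X -> indecomposable (Ret X).
Proof.
move=> X_indec a b.
have [g Gg ge] := X_indec (ret_repr a) (ret_repr b).
have [h Hh he] := permutation_group_Ret _ Gg.
by exists h => //; rewrite -[a]ret_reprK -he ge ret_reprK.
Qed.

End RetractionMap.

(* What the induction needs of a subsolution: bijectivity of the restriction of
   the solution map itself is not demanded, so it need not be rechecked on [Ret X]. *)
Definition self_invariant {X : solution} (Y : set X) : Prop :=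
  forall y, Y y -> forall x,
    (Y (sigma (@smap X) y x) <-> Y x) /\ (Y (tau (@smap X) y x) <-> Y x).

Lemma subsolution_nonempty (X : solution) (Y : set X) :
  subsolution Y -> Y !=set0.
Proof. by case=> stY [[[y /set_mem Yy]] _ _ _ _]; exists y. Qed.

(** Stability gives the implications from right to left. For the others, surjectivity of the
    restricted maps yields a preimage inside [Y], which is [x] by injectivity on [X]. *)
Lemma subsolution_self_invariant {X : solution} (Y : set X) :
  subsolution Y -> self_invariant Y.
Proof.
case=> stY [_ _ _ sbij tbij] y Yy x.
pose in_Y u (Yu : Y u) : Y := exist (fun u => u \in Y) u (mem_set Yu).
split; split=> [Ysx|Yx].
- have [[w wY]] := bij_surj (sbij (in_Y _ Yy)) (in_Y _ Ysx).
  move/(congr1 val) => /= /(bij_inj (solution_sigma_bij (smapP X) y)) <-.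
  exact: set_mem.
- by have [] := stY (y, x) (conj Yy Yx).
- have [[w wY]] := bij_surj (tbij (in_Y _ Yy)) (in_Y _ Ysx).
  move/(congr1 val) => /= /(bij_inj (solution_tau_bij (smapP X) y)) <-.
  exact: set_mem.
- by have [] := stY (x, y) (conj Yx Yy).
Qed.

(** [Y] need not be a union of classes, so [x] itself may lie outside [Y]. Pulling [z] back along
    the action of [y] gives a [w] in [Y], and injectivity on [Ret X] puts [w] in the class of
    [x]. *)
Lemma self_invariant_Ret (X : solution) (Y : set X) :
  self_invariant Y -> @self_invariant (Ret X) (@ret_class X @` Y).
Proof.
move=> Yinv _ [y Yy <-] a; rewrite -(ret_reprK a); move: (ret_repr a) => x.
rewrite sigma_Ret tau_Ret; split; split=> -[z Yz ez].
- have [w wz] := bij_surj (solution_sigma_bij (smapP X) y) z.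
  exists w; first by apply/(Yinv y Yy w).1; rewrite wz.
  apply: (bij_inj (solution_sigma_bij (smapP (Ret X)) (ret_class y))).
  by rewrite !sigma_Ret wz.
- exists (sigma (@smap X) y z); first exact/(Yinv y Yy z).1.
  by rewrite -!sigma_Ret ez.
- have [w wz] := bij_surj (solution_tau_bij (smapP X) y) z.
  exists w; first by apply/(Yinv y Yy w).2; rewrite wz.
  apply: (bij_inj (solution_tau_bij (smapP (Ret X)) (ret_class y))).
  by rewrite !tau_Ret wz.
- exists (tau (@smap X) y z); first exact/(Yinv y Yy z).2.
  by rewrite -!tau_Ret ez.
Qed.

(** Equivalences, unlike one-sided inclusions, pass to inverses even when [Y] is infinite. *)
Lemma permutation_group_preserves (X : solution) (Y : set X) :
  (forall x z, Y (sigma (@smap X) x z) <-> Y z) ->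
  (forall x z, Y (tau (@smap X) x z) <-> Y z) ->
  forall g, @permutation_group X g -> forall z, Y (g z) <-> Y z.
Proof.
move=> Ys Yt g Gg.
suff [] : bijective g /\ forall z, Y (g z) <-> Y z by [].
apply: (permutation_group_sub _
  (fun g => bijective g /\ forall z, Y (g z) <-> Y z)) Gg.
- split=> [? []//| |g1 g2 [b1 e1] [b2 e2]|g1 g2 [b1 e1] gK hK].
  + by split; first exists id.
  + by split=> [|z]; [exact: bij_comp | rewrite /= e1 e2].
  + by split=> [|z]; [exists g1 | rewrite -e1 hK].
- by move=> x; split; first exact: solution_sigma_bij (smapP X) x.
- by move=> x; split; first exact: solution_tau_bij (smapP X) x.
Qed.

Lemma self_invariant_setT n (X : solution) (Y : set X) : indecomposable X ->
  (exists a : iter n Ret X, forall b : iter n Ret X, b = a) ->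
  Y !=set0 -> self_invariant Y -> Y = [set: X].
Proof.
elim: n X Y => [|n IHn] X Y X_indec X_mpl [y Yy] Yinv.
  have [a all_a] := X_mpl.
  by apply/seteqP; split=> // x _; rewrite (all_a x) -(all_a y).
(* Peeling off the innermost [Ret] makes the hypothesis one about [Ret X] at level [n]. *)
rewrite iterSr in X_mpl.
have image_setT : @ret_class X @` Y = [set: Ret X].
  apply: (IHn (Ret X)) => //; first exact: indecomposable_Ret.
    by exists (ret_class y), y.
  exact: self_invariant_Ret.
have acts_as x : exists2 z, Y z &
    same_action (sigma (@smap X)) (tau (@smap X)) z x.
  have [z Yz /ret_classP] : (@ret_class X @` Y) (ret_class x).
    by rewrite image_setT.
  by exists z.
apply/seteqP; split=> // x _; have [g Gg <-] := X_indec y x.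
(* Replace [u] by an element [v] of [Y] with the same action, then use the invariance under [v]. *)
apply/(permutation_group_preserves X Y _ _ g Gg y) => // u z;
  by have [v Yv [es et]] := acts_as u; rewrite -?es -?et; case: (Yinv v Yv z).
Qed.

Lemma subsolution_setT (X : solution) : subsolution [set: X].
Proof.
have stT : stable [set: X] by [].
exists stT.
pose emb (x : X) : [set: X] :=
  exist (fun u => u \in [set: X]) x (mem_set I).
have embP (u : [set: X]) : emb (val u) = u by apply: val_inj.
have restrE p : restriction stT p =
    (emb (smap (val p.1, val p.2)).1, emb (smap (val p.1, val p.2)).2).
  by congr pair; apply: val_inj.
(* Only the equation is kept: it presents the restriction as [smap] transported along the bijection
   [emb], free of membership proofs. *)
move: (restriction stT) restrE => R restrE.
split.
- by case: (solution_inhabited (smapP X)) => x; exists; exact: (emb x).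
- have [r' rK r'K] := solution_bij (smapP X).
  exists (fun p => let q := r' (val p.1, val p.2) in (emb q.1, emb q.2)).
    by move=> [u v]; rewrite restrE /= -surjective_pairing rK /= !embP.
  by move=> [u v]; rewrite restrE /= -surjective_pairing r'K /= !embP.
- move=> [[u v] w]; rewrite /= /r_id /id_r; do !rewrite restrE /=.
  rewrite !smapE /=.
  by rewrite (braid1 (val u)) (braid2 (val u)) (braid3 (val w)).
- move=> u; have [s' sK s'K] := solution_sigma_bij (smapP X) (val u).
  exists (fun v => emb (s' (val v))) => v; rewrite /sigma restrE /=.
    by rewrite [s' _]sK embP.
  by rewrite [(smap _).1]s'K embP.
- move=> u; have [t' tK t'K] := solution_tau_bij (smapP X) (val u).
  exists (fun v => emb (t' (val v))) => v; rewrite /tau restrE /=.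
    by rewrite [t' _]tK embP.
  by rewrite [(smap _).2]t'K embP.
Qed.

Theorem theorem5p1 (X : solution) (X_indec : indecomposable X)
    (X_mpl : finite_multipermutation_level X) (Y : set X) :
  subsolution Y <-> Y = [set: X].
Proof.
have [n Xn] := X_mpl.
split=> [subY|->]; last exact: subsolution_setT.
apply: (self_invariant_setT n) => //; first exact: subsolution_nonempty.
exact: subsolution_self_invariant.
Qed.
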